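(* Let $\mathcal S^*$ be the set of all hyperrectangles in $[0,1]^d$. For any $\epsilon>0$ there exist constants $C_1$ and $C$ depending only on the dimension $d$ and $\epsilon$ such that for all $u,\delta\in(0,1]$ it holds $$\mathcal K\left((\delta u)^{1/2},\rho^*,\{S\in\mathcal S^*:|S|\le\delta\}\right)\le C_1\,\delta^{-(2d-1)}\left(\log(1/\delta)\right)^{d-1}u^{-2d}\left(\log(1/u)\right)^{d-1}\le C\,u^{-(2d+\epsilon)}\,\delta^{-(2d-1+\epsilon)} ,$$ i.e. the bound $\mathcal K((\delta u)^{1/2},\rho^*,\{S\in\mathcal S^*:|S|\le\delta\})\le k_1u^{-k_2}\delta^{-v}$ for all $u,\delta\in(0,1]$ holds true with $k_1=C$, $k_2=2d+\epsilon$ and $v=2d-1+\epsilon$.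
   Context: $\mathcal S^*$ consists of all sets $[s,t]=\{x\in[0,1]^d: s_i\le x_i\le t_i,\ 1\le i\le d\}$. $|\cdot|$ is Lebesgue measure, $\log$ is the natural logarithm, and $\rho^*(R_1,R_2)=\sqrt{|R_1\bigtriangleup R_2|}$ with $\bigtriangleup$ the symmetric difference. The packing number $\mathcal K(\epsilon,\rho,\mathcal W)$ is the maximal number $m$ of elements $W_1,\dots,W_m\in\mathcal W$ with $\rho(W_i,W_j)>\epsilon$ for all $i\ne j$.
   Formalization: In the middle term, log(1/δ) and log(1/u) are read as max(1, log(1/δ)) and max(1, log(1/u)): as written, for d ≥ 2 the middle term vanishes at u = 1 or δ = 1, while the packing number is at least 1. *)

(* Defs.v *)
From HB Require Import structures.
From mathcomp Require Import all_boot all_order all_algebra.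
From mathcomp Require Import all_classical all_reals all_analysis.

Set Implicit Arguments.
Unset Strict Implicit.
Unset Printing Implicit Defensive.

Import Order.TTheory GRing.Theory Num.Theory numFieldNormedType.Exports.
Local Open Scope classical_set_scope.
Local Open Scope ring_scope.

Section cons_measure.
Context {d : measure_display} {T : measurableType d} {R : realType} {n : nat}.

Definition cons_pair (p : T * n.-tuple T) : n.+1.-tuple T :=
  [tuple of p.1 :: p.2].

Definition uncons_pair (x : n.+1.-tuple T) : T * n.-tuple T :=
  (thead x, [tuple of behead x]).

Lemma cons_pairK : cancel cons_pair uncons_pair.
Proof. by case=> x y; congr pair => //; apply: val_inj. Qed.

Lemma uncons_pairK : cancel uncons_pair cons_pair.
Proof. by move=> x; rewrite [RHS]tuple_eta; apply: val_inj. Qed.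

Lemma measurable_cons_pair : measurable_fun setT cons_pair.
Proof. exact: measurable_cons. Qed.

Lemma measurable_uncons_pair : measurable_fun setT uncons_pair.
Proof.
apply: measurable_fun_pair; first exact: measurable_tnth.
exact: measurable_behead.
Qed.

Variables (m1 : {sigma_finite_measure set T -> \bar R})
  (m2 : {sigma_finite_measure set (n.-tuple T) -> \bar R}).

Definition cons_measure : set (n.+1.-tuple T) -> \bar R :=
  pushforward (m1 \x m2)%E cons_pair.

Let cons_measure0 : cons_measure set0 = 0%E.
Proof. by rewrite /cons_measure /pushforward preimage_set0 measure0. Qed.

Let cons_measure_ge0 A : (0 <= cons_measure A)%E.
Proof. by rewrite /cons_measure /pushforward; exact: measure_ge0. Qed.

Let cons_measure_sigma_additive : semi_sigma_additive cons_measure.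
Proof.
exact: (@measure_semi_sigma_additive _ _ _
  (measure_function_pushforward__canonical__measure_function_Measure
     (m1 \x m2)%E measurable_cons_pair)).
Qed.

HB.instance Definition _ := isMeasure.Build _ _ _ cons_measure
  cons_measure0 cons_measure_ge0 cons_measure_sigma_additive.

Let cons_measure_sigma_finite : sigma_finite setT cons_measure.
Proof.
have /sigma_finiteP[F [TF ndF Foo]] := sigma_finiteT m1.
have /sigma_finiteP[G [TG ndG Goo]] := sigma_finiteT m2.
exists (fun k => uncons_pair @^-1` (F k `*` G k)).
  rewrite -preimage_bigcup; apply/esym/seteqP; split => // x _ /=.
  have [i _ Fi] : (\bigcup_k F k) (thead x) by rewrite -TF.
  have [j _ Gj] : (\bigcup_k G k) [tuple of behead x] by rewrite -TG.
  exists (maxn i j) => //; split => /=.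
    by move: Fi; exact/subsetPset/ndF/leq_maxl.
  by move: Gj; exact/subsetPset/ndG/leq_maxr.
move=> k; have [mF Fk] := Foo k; have [mG Gk] := Goo k; split.
  rewrite -[X in measurable X]setTI; apply: measurable_uncons_pair => //.
  exact: measurableX.
rewrite /cons_measure /pushforward -comp_preimage.
rewrite (_ : uncons_pair \o cons_pair = id) ?preimage_id; last first.
  by apply/funext => p /=; rewrite cons_pairK.
by rewrite product_measure1E// lte_mul_pinfty// ge0_fin_numE.
Qed.

HB.instance Definition _ := Measure_isSigmaFinite.Build _ _ _ cons_measure
  cons_measure_sigma_finite.

End cons_measure.

Section lebesgue_tuple.
Context {R : realType}.
Local Notation V := (measurableTypeR R).

(* Lebesgue measure on R^n, on n-tuples of reals with the product
   sigma-algebra: unit mass on R^0, then iterated product with Lebesgue measure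
   on R. *)
Fixpoint lebesgue_tuple n : {sigma_finite_measure set (n.-tuple V) -> \bar R} :=
  if n is n'.+1 then cons_measure (@lebesgue_measure R) (lebesgue_tuple n')
  else dirac ([tuple] : 0.-tuple V).

Lemma lebesgue_tuple_itv n (I : n.-tuple (interval R)) :
  let B := [set x : n.-tuple V | forall i, tnth x i \in tnth I i] in
  measurable B /\
  lebesgue_tuple n B = (\prod_(i < n) lebesgue_measure [set` tnth I i])%E.
Proof.
elim: n I => [|n IHn] I /=.
  rewrite big_ord0 (_ : [set x | _] = setT).
    by split => //; rewrite diracT.
  by apply/seteqP; split => // x _ [].
have [mB muB] := IHn [tuple of behead I].
set B := (X in measurable X) in mB muB.
rewrite (_ : [set x | _] = @uncons_pair _ V n @^-1` ([set` thead I] `*` B)); last first.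
  apply/seteqP; split => x /=.
    move=> Ix; split; first exact: Ix.
    move=> i; rewrite (tuple_eta x) (tuple_eta I) in Ix.
    by have := Ix (lift ord0 i); rewrite !tnthS.
  move=> [x0 xI] i; rewrite (tuple_eta x) (tuple_eta I).
  by case: (unliftP ord0 i) => [j|] ->; rewrite ?tnthS// !tnth0.
have mX : measurable (([set` thead I] : set V) `*` B).
  exact: measurableX.
split.
  have := @measurable_uncons_pair _ V n measurableT _ mX.
  by rewrite setTI.
rewrite /cons_measure /pushforward -comp_preimage.
rewrite (_ : @uncons_pair _ V n \o @cons_pair _ V n = id) ?preimage_id; last first.
  by apply/funext => p /=; rewrite cons_pairK.
rewrite product_measure1E// big_ord_recl muB; congr (_ * _)%E.
by apply: eq_bigr => i _; rewrite [I in RHS]tuple_eta tnthS.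
Qed.

End lebesgue_tuple.

Section hyperrectangles.
Context {R : realType} {d : nat}.
Local Notation V := (measurableTypeR R).
Implicit Types (s t : d.-tuple V) (A B : set (d.-tuple V)).

Definition unit_cube : set (d.-tuple V) :=
  [set x | forall i, 0 <= tnth x i <= 1].

Definition hyperrectangle s t : set (d.-tuple V) :=
  [set x | unit_cube x /\ forall i, tnth s i <= tnth x i <= tnth t i].

Definition hyperrectangles : set (set (d.-tuple V)) :=
  [set S | exists s t, S = hyperrectangle s t].

Definition symdiff_dist A B : R := Num.sqrt (fine (lebesgue_tuple d (A `+` B))).

End hyperrectangles.
Arguments hyperrectangles R d : clear implicits.

(* Supremum in \bar R of the cardinalities of eps-separated families, hence
   +oo when there are arbitrarily large ones. *)
Definition packing_number {R : realType} {T : Type} (eps : R)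
    (rho : T -> T -> R) (W : set T) : \bar R :=
  ereal_sup [set m%:R%:E | m in [set m : nat | exists w : 'I_m -> T,
    (forall i, W (w i)) /\ (forall i j, i != j -> eps < rho (w i) (w j))]].

Definition hyperrectangle_packing {R : realType} (d : nat) (u delta : R) :
    \bar R :=
  packing_number (Num.sqrt (delta * u)) symdiff_dist
    [set S | hyperrectangles R d S /\ (lebesgue_tuple d S <= delta%:E)%E].

Definition packing_bound {R : realType} (d : nat) (k1 k2 v : R) : Prop :=
  forall u delta, 0 < u <= 1 -> 0 < delta <= 1 ->
  (hyperrectangle_packing d u delta <= (k1 * u `^ (- k2) * delta `^ (- v))%:E)%E.

(* The packing number of a nonempty class is at least 1, whereas ln x^-1
   vanishes at x = 1, so a factor ln x^-1 in an upper bound valid on the whole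
   range 0 < x <= 1 has to be bounded away from 0.  For x <= expR (-1),
   log_trunc x^-1 is ln x^-1. *)
Definition log_trunc {R : realType} (x : R) : R := Num.max 1 (ln x).

Lemma packing_number_ge1 {R : realType} (T : Type) (eps : R)
  (rho : T -> T -> R) (W : set T) : W !=set0 -> (1 <= packing_number eps rho W)%E.
Proof.
move=> [x Wx]; apply: ereal_sup_ubound; exists 1%N => //=.
by exists (fun=> x); split => // i j; rewrite !ord1 eqxx.
Qed.

(* Main.v *)
Require Import Defs.
From mathcomp Require Import all_boot all_order all_algebra.
From mathcomp Require Import all_classical all_reals all_analysis.
From mathcomp Require Import ring lra.
Import Order.TTheory GRing.Theory Num.Theory numFieldNormedType.Exports.
Local Open Scope classical_set_scope.
Local Open Scope ring_scope.

(* Round the lower corner s and the side lengths t - s of a rectangle [s, t]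
   down to the grid of mesh 1/N, with N of order 1/(delta u).  Two rectangles
   with the same roundings differ only inside 2d slabs of total volume at most
   3d/N <= delta u, so a separated family has at most as many members as there
   are pairs of roundings.  There are (N+1)^d roundings of the lower corner,
   and since the sides have product at most delta, their roundings q satisfy
   prod_i max(1, q_i) <= N^d delta; the number of such q is
   O(N^d delta (log N)^(d-1)), as in Dirichlet's divisor problem. *)

(** * Counting integer vectors with bounded product *)

(** This is [ln (1 + x) <= x] at x = -1/(n+1). *)
Lemma invS_le_lnB (R : realType) (n : nat) : (0 < n)%N ->
  n.+1%:R^-1 <= ln n.+1%:R - ln n%:R :> R.
Proof.
move=> n0; have n0R : (0 : R) < n%:R by rewrite ltr0n.
have S0 : (0 : R) < n.+1%:R by rewrite ltr0n.
have e : 1 + - n.+1%:R^-1 = n%:R / n.+1%:R :> R.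
  by rewrite -natr1 in S0 *; field; rewrite gt_eqF.
have := @le_ln1Dx R (- n.+1%:R^-1).
rewrite e ln_div ?posrE// ltrN2 invf_lt1// ltr1n ltnS n0 lerNr opprB.
exact.
Qed.

(** The terms k = 0 and k = 1 both equal 1; the others telescope by [invS_le_lnB]. *)
Lemma sum_inv_maxn_le (R : realType) (n : nat) : (0 < n)%N ->
  \sum_(k < n.+1) (maxn 1 k)%:R^-1 <= 2 + ln n%:R :> R.
Proof.
elim: n => // -[|n] IHn _.
  rewrite 2!big_ord_recl big_ord0 /= ln1 (_ : maxn 1 0 = 1)%N//.
  by rewrite (_ : maxn 1 _ = 1)%N// invr1; lra.
rewrite big_ord_recr/=; have := IHn isT.
have := @invS_le_lnB R n.+1 isT.
rewrite (_ : maxn 1 n.+2 = n.+2)// => h1 h2.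
by apply: le_trans (lerD h2 h1) _; rewrite -addrA subrKC.
Qed.

(** Nothing is counted when y < 1; otherwise k <= floor y leaves at most floor y + 1 <= 2y
    values. *)
Lemma card_maxn_le (R : realType) (n : nat) (y : R) : 0 <= y ->
  #|[pred k : 'I_n | (maxn 1 k)%:R <= y]|%:R <= 2 * y.
Proof.
move=> y0; have [y1|y1] := ltP y 1.
  rewrite eq_card0 ?mulr_ge0// => k; rewrite !inE; apply/negP => ky.
  have : (1 : R) <= (maxn 1 k)%:R by rewrite ler1n leq_max.
  lra.
set A := [pred k | _]; have Ale (k : 'I_n) : k \in A -> (k <= Num.truncn y)%N.
  rewrite inE => ky; rewrite truncn_ge_nat//; apply: le_trans ky.
  by rewrite ler_nat leq_maxr.
have Ainj : {in A &, injective (fun k : 'I_n => inord k : 'I_(Num.truncn y).+1)}.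
  move=> k k' /Ale kA /Ale kA' /(congr1 val)/=; rewrite !inordK// => ?.
  exact: val_inj.
have := leq_card_in _ _ Ainj; rewrite card_ord -(ler_nat R) => /le_trans; apply.
have := truncn_itv y0; rewrite -natr1; lra.
Qed.
(* Once the last d coordinates are fixed, the number of choices of the first is
   at most linear in X; the remaining sum factors into d harmonic sums. *)
Lemma card_prod_maxn_le (R : realType) (n d : nat) (X : R) :
  (0 < n)%N -> 0 <= X ->
  #|[pred q : {ffun 'I_d.+1 -> 'I_n.+1} |
      \prod_i (maxn 1 (q i))%:R <= X]|%:R <= 2 * X * (2 + ln n%:R) ^+ d.
Proof.
move=> n0 X0; set P := [pred q | _].
pose tl (q : {ffun 'I_d.+1 -> 'I_n.+1}) := [ffun i : 'I_d => q (lift ord0 i)].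
have p0 (k : 'I_n.+1) : (0 : R) < (maxn 1 k)%:R by rewrite ltr0n leq_max.
rewrite -sum1_card (partition_big tl xpredT)//= natr_sum.
apply: (@le_trans _ _ (\sum_(r : {ffun 'I_d -> 'I_n.+1})
    2 * (X * \prod_i (maxn 1 (r i))%:R^-1))).
  apply: ler_sum => r _; rewrite sum1_card.
  apply: le_trans (card_maxn_le R n.+1 _ _); last first.
    by rewrite mulr_ge0// prodr_ge0// => i _; rewrite invr_ge0 ler0n.
  rewrite ler_nat.
  set A := (A in (#|A| <= _)%N).
  (* Members of one fibre of [tl] agree off [ord0], so their value there tells them apart. *)
  have Ainj : {in A &, injective (fun q : {ffun 'I_d.+1 -> 'I_n.+1} => q ord0)}.
    move=> q q' /andP[_ /eqP qr] /andP[_ /eqP qr'] e; apply/ffunP => i.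
    case: (unliftP ord0 i) => [j|] -> //.
    by move/ffunP: qr => /(_ j); move/ffunP: qr' => /(_ j); rewrite !ffunE => -> ->.
  rewrite -(card_in_image Ainj); apply/subset_leq_card/fintype.subsetP => k.
  move=> /fintype.imageP[q] => /andP[Pq /eqP qr] ->; move: Pq; rewrite !inE big_ord_recl.
  rewrite prodfV ler_pdivlMr; last by apply: prodr_gt0 => i _.
  by congr (_ * _ <= _); apply: eq_bigr => i _; rewrite -qr ffunE.
rewrite -mulr_sumr -mulr_sumr -mulrA ler_wpM2l// ler_wpM2l//.
rewrite -(bigA_distr_bigA (fun (i : 'I_d) (k : 'I_n.+1) => (maxn 1 k)%:R^-1 : R)).
rewrite big_const_ord iter_mulr_1 lerXn2r ?nnegrE ?sum_inv_maxn_le//.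
  by apply: sumr_ge0 => i _; rewrite invr_ge0.
by rewrite addr_ge0// ln_ge0// ler1n.
Qed.

(** * Volumes of rectangles, slabs and grid gaps *)

(** Clamping the corners absorbs the unit cube condition and leaves a plain product of intervals, as
    [lebesgue_tuple_itv] requires. *)
Lemma hyperrectangle_itv (R : realType) (d : nat)
    (s t : d.-tuple (measurableTypeR R)) :
  let I := [tuple `[Num.max 0 (tnth s i), Num.min 1 (tnth t i)] | i < d] in
  hyperrectangle s t = [set x | forall i, tnth x i \in tnth I i].
Proof.
apply/seteqP; split => x /=.
  move=> [cx sx] i; rewrite tnth_mktuple in_itv/= ge_max le_min.
  by case/andP: (cx i) => -> ->; case/andP: (sx i) => -> ->.
move=> h; split=> i; move: (h i); rewrite tnth_mktuple in_itv/= ge_max le_min;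
  by move=> /andP[/andP[x0 sx] /andP[x1 xt]]; rewrite ?x0 ?sx.
Qed.

Lemma measurable_hyperrectangle (R : realType) (d : nat)
  (s t : d.-tuple (measurableTypeR R)) : measurable (hyperrectangle s t).
Proof. rewrite hyperrectangle_itv; exact: (lebesgue_tuple_itv _).1. Qed.

(** A reversed interval would have measure 0 but a negative difference of endpoints; the hypothesis
    excludes this. *)
Lemma lebesgue_tuple_hyperrectangle (R : realType) (d : nat)
    (s t : d.-tuple (measurableTypeR R)) :
  (forall i, Num.max 0 (tnth s i) <= Num.min 1 (tnth t i)) ->
  lebesgue_tuple d (hyperrectangle s t) =
  (\prod_(i < d) (Num.min 1 (tnth t i) - Num.max 0 (tnth s i)))%:E.
Proof.
move=> st; rewrite hyperrectangle_itv (lebesgue_tuple_itv _).2.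
rewrite -prodEFin; apply: eq_bigr => i _; rewrite tnth_mktuple.
rewrite lebesgue_measure_itv/= lte_fin; case: ltP => // h.
have -> : Num.min 1 (tnth t i) = Num.max 0 (tnth s i).
  by apply/le_anti; rewrite h st.
by rewrite subrr.
Qed.

Definition slab (R : realType) (d : nat) (i : 'I_d) (a b : R) :
    set (d.-tuple (measurableTypeR R)) :=
  [set x | unit_cube x /\ a <= tnth x i <= b].

Lemma slab_hyperrectangle (R : realType) (d : nat) (i : 'I_d) (a b : R) :
  slab R d i a b = hyperrectangle [tuple if j == i then a else 0 | j < d]
                            [tuple if j == i then b else 1 | j < d].
Proof.
apply/seteqP; split => x [cx h]; split => //.
  by move=> j; rewrite !tnth_mktuple; case: eqP => [->|_].
by move: (h i); rewrite !tnth_mktuple eqxx.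
Qed.

Lemma measurable_slab (R : realType) (d : nat) (i : 'I_d) (a b : R) :
  measurable (slab R d i a b).
Proof. rewrite slab_hyperrectangle; exact: measurable_hyperrectangle. Qed.

(** All sides but the i-th are [0, 1], and clamping to the cube can only shorten the i-th one. *)
Lemma lebesgue_tuple_slab_le (R : realType) (d : nat) (i : 'I_d) (a b : R) :
  a <= b -> (lebesgue_tuple d (slab R d i a b) <= (b - a)%:E)%E.
Proof.
move=> ab; rewrite slab_hyperrectangle hyperrectangle_itv (lebesgue_tuple_itv _).2.
rewrite (bigD1 i)//= big1 ?mule1; last first.
  move=> j ji; rewrite tnth_mktuple lebesgue_measure_itv/= !tnth_mktuple (negbTE ji).
  by rewrite maxxx minxx lte_fin ltr01 oppr0 adde0.
rewrite tnth_mktuple lebesgue_measure_itv/= !tnth_mktuple eqxx.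
case: ifPn => _; last by rewrite lee_fin subr_ge0.
rewrite lee_fin lerB// ?ge_min ?le_max lexx ?orbT//.
Qed.

(* All rectangles whose lower corner rounds down to a / N and whose side lengths
   round down to q / N lie between the next two sets; the upper corner of such
   a rectangle is only known up to 2 / N.  The inner set may be empty. *)
Definition grid_inner (R : realType) (d N : nat) (a q : {ffun 'I_d -> 'I_N.+1}) :
    set (d.-tuple (measurableTypeR R)) :=
  hyperrectangle [tuple (a i).+1%:R / N%:R | i < d]
                 [tuple (a i + q i)%:R / N%:R | i < d].

Definition grid_outer (R : realType) (d N : nat) (a q : {ffun 'I_d -> 'I_N.+1}) :
    set (d.-tuple (measurableTypeR R)) :=
  hyperrectangle [tuple (a i)%:R / N%:R | i < d]
                 [tuple (a i + q i).+2%:R / N%:R | i < d].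

(** A point of the gap violates an inner constraint in some coordinate, so it lies in a lower slab
    of width 1/N or an upper slab of width 2/N. Each coordinate thus costs 3/N. *)
Lemma lebesgue_tuple_grid_gap (R : realType) (d N : nat) (a q : {ffun 'I_d -> 'I_N.+1}) :
  (0 < N)%N ->
  (lebesgue_tuple d (grid_outer R d N a q `\` grid_inner R d N a q) <=
   (3 * d%:R / N%:R)%:E)%E.
Proof.
move=> N0; set G := _ `\` _.
have mG : measurable G by apply: measurableD; exact: measurable_hyperrectangle.
have N0R : (0 : R) < N%:R by rewrite ltr0n.
pose L i := slab R d i ((a i)%:R / N%:R) ((a i).+1%:R / N%:R).
pose U i := slab R d i ((a i + q i)%:R / N%:R) ((a i + q i).+2%:R / N%:R).
have mLU i : measurable (L i `|` U i).
  by apply: measurableU; exact: measurable_slab.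
have GLU : G `<=` \bigcup_(i in setT) (L i `|` U i).
  move=> x [[cx xo] xi]; apply: contrapT => h; apply: xi; split => // i.
  move: (xo i); rewrite !tnth_mktuple => /andP[ax xq].
  apply/andP; split; rewrite leNgt; apply/negP => lt; apply: h; exists i => //.
    by left; split => //; rewrite ax ltW.
  by right; split => //; rewrite xq ltW.
have fin : finite_set [set` index_enum 'I_d] by exact: finite_seq.
have GLU' : G `<=` \bigcup_(i in [set` index_enum 'I_d]) (L i `|` U i).
  by move=> x /GLU[i _ LUi]; exists i => //=; rewrite mem_index_enum.
apply: le_trans (content_sub_fsum _ fin (fun i _ => mLU i) mG GLU') _.
rewrite -fsbig_seq ?index_enum_uniq//.
have -> : 3 * d%:R / N%:R = \sum_(i < d) (3 / N%:R) :> R.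
  by rewrite sumr_const card_ord -mulr_natl; ring.
rewrite -sumEFin; apply: lee_sum => i _.
apply: le_trans (measureU2 _ _ _) _; try exact: measurable_slab.
have gap (m k : nat) :
    m%:R / N%:R <= (m + k)%:R / N%:R :> R /\
    (m + k)%:R / N%:R - m%:R / N%:R = k%:R / N%:R :> R.
  rewrite natrD mulrDl [_ + _ - _]addrAC subrr add0r; split => //.
  by rewrite lerDl divr_ge0// ltW.
have [leL eL] := gap (a i) 1%N; have [leU eU] := gap (a i + q i)%N 2%N.
have -> : (3 / N%:R)%:E = (1 / N%:R)%:E + (2 / N%:R)%:E :> \bar R.
  by rewrite -EFinD -mulrDl.
rewrite addn1 in leL eL; rewrite addn2 in leU eU.
rewrite -eL -eU; apply: leeD; exact: lebesgue_tuple_slab_le.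
Qed.

(** * Rounding a rectangle to the grid *)

Lemma grid_bracket (R : realType) (d N : nat) (delta : R)
    (S : set (d.-tuple (measurableTypeR R))) :
  (0 < d)%N -> (0 < N)%N -> 0 < delta -> 1 <= N%:R * delta ->
  hyperrectangles R d S -> (lebesgue_tuple d S <= delta%:E)%E ->
  exists a q : {ffun 'I_d -> 'I_N.+1},
    [/\ grid_inner R d N a q `<=` S, S `<=` grid_outer R d N a q &
     \prod_i (maxn 1 (q i))%:R <= N%:R ^+ d * delta].
Proof.
move=> d0 N0 delta0 Nd [s [t ->]] volS.
have N0R : (0 : R) < N%:R by rewrite ltr0n.
have Nge1 : (1 : R) <= N%:R by rewrite ler1n.
(* From N delta >= 1; it serves both the empty rectangle and a side shorter than 1/N. *)
have NX : N%:R ^+ d.-1 <= N%:R ^+ d * delta.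
  by rewrite -[in leRHS](prednK d0) exprSr -mulrA ler_peMr// exprn_ge0// ltW.
case: (pselect (hyperrectangle s t !=set0)) => [[x Sx]|/set0P/negP/negbNE/eqP S0]; last first.
  (* For empty S, zero roundings work: the inner set would need 1/N <= x_i <= 0, which is absurd
     since there is at least one coordinate. *)
  exists [ffun=> ord0], [ffun=> ord0]; rewrite S0; split => //.
  - move=> x [cx /(_ (Ordinal d0))]; rewrite !tnth_mktuple !ffunE/= addn0.
    move=> /andP[/le_trans/[apply]]; rewrite mul0r mul1r invr_le0 leNgt N0R//.
  - rewrite big1 => [|i _]; last by rewrite ffunE.
    by apply: le_trans NX; rewrite exprn_ege1.
have itvS := hyperrectangle_itv R d s t.
pose l i := Num.max 0 (tnth s i); pose h i := Num.min 1 (tnth t i).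
have SE y : hyperrectangle s t y <-> forall i, l i <= tnth y i <= h i.
  rewrite itvS/=; split => H i; move: (H i); rewrite tnth_mktuple in_itv//=.
have lh i : l i <= h i by have /andP[] := (SE x).1 Sx i; exact: le_trans.
have l0 i : 0 <= l i by rewrite le_max lexx.
have h1 i : h i <= 1 by rewrite ge_min lexx.
move: volS; rewrite lebesgue_tuple_hyperrectangle// lee_fin -/(l _) -/(h _) => volS.
pose A i := Num.truncn (N%:R * l i); pose Q i := Num.truncn (N%:R * (h i - l i)).
have NA i : (A i)%:R <= N%:R * l i < (A i).+1%:R by rewrite truncn_itv// mulr_ge0// ltW.
have NQ i : (Q i)%:R <= N%:R * (h i - l i) < (Q i).+1%:R.
  by rewrite truncn_itv// mulr_ge0 ?subr_ge0// ltW.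
have AN i : (A i < N.+1)%N.
  rewrite ltnS -(ler_nat R); case/andP: (NA i) => /le_trans + _; apply.
  by rewrite ler_piMr// (le_trans (lh i)).
have QN i : (Q i < N.+1)%N.
  rewrite ltnS -(ler_nat R); case/andP: (NQ i) => /le_trans + _; apply.
  by rewrite ler_piMr// lerBlDr (le_trans (h1 i))// lerDl.
have QX : \prod_i (maxn 1 (Q i))%:R <= N%:R ^+ d * delta.
  (* A side shorter than 1/N makes the volume bound useless: the factor 1 replaces
     it, and N^(d-1) bounds the others. *)
  have [/existsP[i /eqP Qi]|/existsPn Q0] := boolP [exists i, Q i == 0%N].
    apply: le_trans NX; rewrite (bigD1 i)//= Qi mul1r.
    rewrite (_ : N%:R ^+ d.-1 = \prod_(j < d | j != i) N%:R).
      by apply: ler_prod => j _; rewrite ler0n ler_nat geq_max N0/= -ltnS.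
    by rewrite prodr_const cardC1 card_ord.
  apply: le_trans (_ : \prod_i (N%:R * (h i - l i)) <= _).
    apply: ler_prod => i _; rewrite ler0n (maxn_idPr _) ?lt0n//.
    by case/andP: (NQ i).
  by rewrite big_split/= prodr_const card_ord ler_wpM2l// exprn_ge0// ltW.
exists [ffun i => Ordinal (AN i)], [ffun i => Ordinal (QN i)]; split.
- move=> y [cy ay]; apply/SE => i; move: (ay i); rewrite !tnth_mktuple !ffunE/=.
  rewrite ler_pdivrMr// ler_pdivlMr// ![tnth y i * _]mulrC => /andP[ly yh].
  rewrite -(ler_pM2l N0R (l i)) -(ler_pM2l N0R _ (h i)).
  move: (NA i) (NQ i) => /andP[Al lA] /andP[Qhl hlQ].
  by rewrite natrD in yh; rewrite mulrBr in Qhl; apply/andP; split; lra.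
- move=> y Sy; split=> [|i]; first by case: Sy.
  rewrite !tnth_mktuple !ffunE/=.
  rewrite ler_pdivrMr// ler_pdivlMr// ![tnth y i * _]mulrC.
  have := (SE y).1 Sy i.
  rewrite -(ler_pM2l N0R (l i)) -(ler_pM2l N0R _ (h i)) => /andP[ly yh].
  move: (NA i) (NQ i) => /andP[Al lA] /andP[Qhl hlQ].
  (* The two roundings each lose less than 1, hence the 2 in [grid_outer]. *)
  have -> : (A i + Q i).+2 = ((A i).+1 + (Q i).+1)%N by rewrite addSn addnS.
  rewrite natrD; rewrite mulrBr in hlQ; apply/andP; split; lra.
- by under eq_bigr do rewrite ffunE.
Qed.

(** * From roundings to the packing number *)

Lemma symdiff_dist_le (R : realType) (d : nat) (x : R)
    (I O A B : set (d.-tuple (measurableTypeR R))) :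
  measurable A -> measurable B -> measurable (O `\` I) ->
  I `<=` A -> A `<=` O -> I `<=` B -> B `<=` O ->
  (lebesgue_tuple d (O `\` I) <= x%:E)%E ->
  symdiff_dist A B <= Num.sqrt x.
Proof.
move=> mA mB mOI IA AO IB BO OIx; rewrite /symdiff_dist.
have AB : A `+` B `<=` O `\` I.
  rewrite setY_def => y [[Ay nBy]|[By nAy]]; split; by [exact: AO|exact: BO|move/IB|move/IA].
have mAB : measurable (A `+` B).
  by rewrite setY_def; apply: measurableU; exact: measurableD.
have ABx : (lebesgue_tuple d (A `+` B) <= x%:E)%E.
  by apply: le_trans OIx; apply: le_measure; rewrite ?inE.
(* [fine] sends infinite values to 0, so finiteness of the measure has to be checked first. *)
apply: ler_wsqrtr; rewrite -lee_fin fineK// ge0_fin_numE//.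
by rewrite (le_lt_trans ABx)// ltry.
Qed.

(** Rounding is injective on a separated family: two members with equal roundings would be at
    distance at most sqrt(3d/N) <= sqrt(delta u). *)
Lemma hyperrectangle_packing_card (R : realType) (d N : nat) (u delta : R) :
  (0 < d)%N -> (0 < N)%N -> 0 < u <= 1 -> 0 < delta ->
  3 * d%:R / (delta * u) <= N%:R ->
  (hyperrectangle_packing d u delta <=
   (N.+1 ^ d * #|[pred q : {ffun 'I_d -> 'I_N.+1} |
      (\prod_i (maxn 1 (q i))%:R <= N%:R ^+ d * delta :> R)]|)%:R%:E)%E.
Proof.
move=> d0 N0 /andP[u0 u1] delta0 Nge; set Q := [pred q | _].
have N0R : (0 : R) < N%:R by rewrite ltr0n.
have du0 : 0 < delta * u by rewrite mulr_gt0.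
have dge1 : (1 : R) <= d%:R by rewrite ler1n.
have gap : 3 * d%:R / N%:R <= delta * u.
  by move: Nge; rewrite !ler_pdivrMr// [N%:R * _]mulrC.
have Nd : 1 <= N%:R * delta.
  have : 3 * d%:R <= N%:R * (delta * u) by rewrite -ler_pdivrMr.
  have : N%:R * (delta * u) <= N%:R * delta.
    by rewrite mulrA ler_piMr// mulr_ge0// ltW.
  lra.
apply: ge_ereal_sup => _ /= [m [w [wW wsep]] <-]; rewrite lee_fin ler_nat.
have br i := grid_bracket R d N delta (w i) d0 N0 delta0 Nd (wW i).1 (wW i).2.
have {br}/choice[c cP] i : exists c : {ffun 'I_d -> 'I_N.+1} * {ffun 'I_d -> 'I_N.+1},
    [/\ grid_inner R d N c.1 c.2 `<=` w i,
      w i `<=` grid_outer R d N c.1 c.2 & c.2 \in Q].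
  by have [a [q [? ? ?]]] := br i; exists (a, q); split.
have mw i : measurable (w i).
  by have [s [t ->]] := (wW i).1; exact: measurable_hyperrectangle.
have cinj : injective c.
  move=> i j cij; apply/eqP/negPn/negP => ij; have := wsep i j ij.
  rewrite ltNge => /negP; apply.
  have [Ii Oi _] := cP i; have [Ij Oj _] := cP j; rewrite -cij in Ij Oj.
  apply: (symdiff_dist_le _ _ _ _ _ _ _ (mw i) (mw j) _ Ii Oi Ij Oj).
    by apply: measurableD; exact: measurable_hyperrectangle.
  by apply: le_trans (lebesgue_tuple_grid_gap _ _ _ _ _ N0) _; rewrite lee_fin.
have -> : (N.+1 ^ d = #|predT : pred {ffun 'I_d -> 'I_N.+1}|)%N.
  by rewrite [RHS]card_ffun !card_ord.
rewrite -cardX -[leqLHS]card_ord -(card_codom cinj).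
apply/subset_leq_card/fintype.subsetP => _ /codomP[i ->].
by rewrite !inE; have [_ _] := cP i; rewrite inE.
Qed.

(** * The explicit bound with logarithms *)

(** With N <= 6d/(delta u): the 2 comes from [card_prod_maxn_le], 2^d from (N+1)^d <= (2N)^d, the
    power of 6d from N^(2d), and the last factor from 2 + ln N. *)
Definition packing_constant (R : realType) (d : nat) : R :=
  2 * 2 ^+ d * (6 * d%:R) ^+ (2 * d) * (4 + ln (6 * d%:R)) ^+ (d - 1).

Lemma ln_le_log_trunc (R : realType) (x : R) : ln x <= log_trunc x.
Proof. by rewrite le_max lexx orbT. Qed.

Lemma log_trunc_ge1 (R : realType) (x : R) : 1 <= log_trunc x.
Proof. by rewrite le_max lexx. Qed.

Lemma hyperrectangle_packing_le (R : realType) (d : nat) (u delta : R) :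
  (0 < d)%N -> 0 < u <= 1 -> 0 < delta <= 1 ->
  (hyperrectangle_packing d u delta <=
   (packing_constant R d
     * delta `^ (- (2 * d%:R - 1)) * log_trunc delta^-1 ^+ (d - 1)
     * u `^ (- (2 * d%:R)) * log_trunc u^-1 ^+ (d - 1))%:E)%E.
Proof.
move=> d0 u01 /andP[delta0 delta1]; have /andP[u0 u1] := u01.
have dge1 : (1 : R) <= d%:R by rewrite ler1n.
have du0 : 0 < delta * u by rewrite mulr_gt0.
have du1 : delta * u <= 1 by rewrite mulr_ile1// ltW.
set y := 3 * d%:R / (delta * u).
have y1 : 1 <= y by rewrite ler_pdivlMr// mul1r; lra.
pose N := (Num.truncn y).+1.
have yN : y <= N%:R by rewrite ltW// truncnS_gt.
(* Since y >= 1, N <= y + 1 <= 2y. *)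
have N2y : N%:R <= 6 * d%:R / (delta * u).
  have : N%:R <= y + 1.
    by rewrite -[N%:R]natr1 lerD2r; have /andP[] := @truncn_itv R y (le_trans ler01 y1).
  have -> : 6 * d%:R / (delta * u) = 2 * y by rewrite /y; ring.
  lra.
have N0 : (0 < N)%N by [].
have Nge1 : (1 : R) <= N%:R by rewrite ler1n.
have lnN : 2 + ln N%:R <= (4 + ln (6 * d%:R)) * log_trunc delta^-1 * log_trunc u^-1.
  have l6 : 0 <= ln (6 * d%:R) :> R by apply: ln_ge0; lra.
  have L1 := log_trunc_ge1 R delta^-1; have L2 := log_trunc_ge1 R u^-1.
  have : ln N%:R <= ln (6 * d%:R) + (log_trunc delta^-1 + log_trunc u^-1).
    apply: le_trans (_ : ln (6 * d%:R / (delta * u)) <= _).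
      by rewrite ler_ln ?posrE// divr_gt0//; lra.
    have d6 : 0 < 6 * d%:R :> R by lra.
    rewrite invfM [leLHS]lnM ?posrE//; last by rewrite divr_gt0 ?invr_gt0.
    rewrite lerD2l lnM ?posrE ?invr_gt0//.
    by apply: lerD; exact: ln_le_log_trunc.
  move: (ln N%:R) (ln (6 * d%:R)) l6 (log_trunc delta^-1) L1 (log_trunc u^-1) L2.
  move=> a b b0 p p1 q q1 h.
  (* As p, q >= 1, each of 2 and p + q is at most 2pq, which gives the 4; b is at most b pq. *)
  have pq : p + q <= 2 * (p * q) by nra.
  have b1 : b <= b * (p * q) by nra.
  nra.
apply: le_trans (hyperrectangle_packing_card _ _ N _ _ d0 N0 u01 delta0 yN) _.
rewrite lee_fin natrM natrX.
have cardQ : #|[pred q : {ffun 'I_d -> 'I_N.+1} |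
      (\prod_i (maxn 1 (q i))%:R <= N%:R ^+ d * delta :> R)]|%:R
    <= 2 * (N%:R ^+ d * delta) * (2 + ln N%:R) ^+ (d - 1).
  case: (d) d0 => // d' _; rewrite subn1/=.
  by apply: card_prod_maxn_le => //; rewrite mulr_ge0 ?exprn_ge0// ltW.
have N2 : N.+1%:R <= 2 * N%:R :> R by rewrite -natr1; lra.
have lnN0 : 0 <= 2 + ln N%:R :> R by rewrite addr_ge0// ln_ge0.
apply: (@le_trans _ _ ((2 * N%:R) ^+ d *
    (2 * (N%:R ^+ d * delta) * (2 + ln N%:R) ^+ (d - 1)))).
  by apply: ler_pM => //; rewrite ?exprn_ge0// lerXn2r// nnegrE; lra.
have -> : (2 * N%:R) ^+ d * (2 * (N%:R ^+ d * delta) * (2 + ln N%:R) ^+ (d - 1))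
    = 2 * 2 ^+ d * delta * (N%:R ^+ (2 * d) * (2 + ln N%:R) ^+ (d - 1)) :> R.
  by rewrite mul2n -addnn exprD exprMn; ring.
have -> : packing_constant R d
     * delta `^ (- (2 * d%:R - 1)) * log_trunc delta^-1 ^+ (d - 1)
     * u `^ (- (2 * d%:R)) * log_trunc u^-1 ^+ (d - 1) =
   2 * 2 ^+ d * delta * ((6 * d%:R / (delta * u)) ^+ (2 * d)
     * ((4 + ln (6 * d%:R)) * log_trunc delta^-1 * log_trunc u^-1) ^+ (d - 1)).
  (* The single factor delta from the volume bound turns delta^(-2d) into delta^(1-2d). *)
  rewrite opprB powRB; last by rewrite (gt_eqF delta0) implybT.
  rewrite powRr1 ?ltW// powRN -(natrM _ 2 d) !powR_mulrn ?ltW//.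
  rewrite /packing_constant !exprMn exprVn exprMn invfM.
  by ring.
rewrite ler_wpM2l//.
  by rewrite !mulr_ge0 ?exprn_ge0// ltW.
by apply: ler_pM; rewrite ?exprn_ge0// lerXn2r// nnegrE;
  [lra|apply: le_trans N2y; lra|apply: le_trans lnN].
Qed.

(** * Absorbing logarithms into powers *)

(** Apply ln z <= z - 1 to z = x^(-a) with a = eps/(n+1); the n-th power costs an exponent n a <=
    eps. Dividing by n + 1 keeps a meaningful at n = 0. *)
Lemma log_trunc_expr_le_powR (R : realType) (n : nat) (eps x : R) :
  0 < eps -> 0 < x <= 1 ->
  log_trunc x^-1 ^+ n <= (1 + n.+1%:R / eps) ^+ n * x `^ (- eps).
Proof.
move=> eps0 /andP[x0 x1]; set a := eps / n.+1%:R.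
have a0 : 0 < a by rewrite divr_gt0.
have ai : n.+1%:R / eps = a^-1 by rewrite invfM invrK mulrC.
have ai0 : 0 < a^-1 by rewrite invr_gt0.
have p1 : 1 <= x `^ (- a).
  by rewrite -[leLHS](powRr0 x) ger_powR ?x0// oppr_le0 ltW.
have lnx : ln x^-1 <= a^-1 * x `^ (- a).
  have -> : ln x^-1 = a^-1 * ln (x `^ (- a)).
    by rewrite ln_powR lnV ?posrE// mulNr mulrN mulKf ?gt_eqF.
  rewrite ler_pM2l//; have := @le_ln1Dx R (x `^ (- a) - 1).
  by rewrite subrKC => h; apply: le_trans (h _) _; lra.
have le1 : log_trunc x^-1 <= (1 + a^-1) * x `^ (- a).
  (* The summand 1 in 1 + 1/a covers the truncation at 1, because x^(-a) >= 1. *)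
  by rewrite ge_max mulrDl mul1r; apply/andP; split; nra.
rewrite ai; apply: le_trans (_ : ((1 + a^-1) * x `^ (- a)) ^+ n <= _).
  rewrite lerXn2r// nnegrE; first exact: le_trans (log_trunc_ge1 _ _).
  by rewrite mulr_ge0 ?powR_ge0//; lra.
rewrite exprMn ler_wpM2l// ?exprn_ge0//; first lra.
rewrite -powR_mulrn ?powR_ge0// -powRrM ger_powR ?x0//.
rewrite mulNr lerN2 /a mulrAC ler_pdivrMr// ler_pM2l// ler_nat//.
Qed.

Theorem lemmaA1 (R : realType) (d : nat) (hd : (0 < d)%N)
    (eps : R) (heps : 0 < eps) :
  exists C1 C : R,
    (forall u delta : R, 0 < u <= 1 -> 0 < delta <= 1 ->
      let B := C1 * delta `^ (- (2 * d%:R - 1)) * log_trunc delta^-1 ^+ (d - 1)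
                  * u `^ (- (2 * d%:R)) * log_trunc u^-1 ^+ (d - 1) in
      (hyperrectangle_packing d u delta <= B%:E)%E /\
      B <= C * u `^ (- (2 * d%:R + eps)) * delta `^ (- (2 * d%:R - 1 + eps))) /\
    packing_bound d C (2 * d%:R + eps) (2 * d%:R - 1 + eps).
Proof.
pose C1 : R := packing_constant R d.
(* The constant of [log_trunc_expr_le_powR] at n = d - 1; the logarithms in u and in delta
   contribute it once each, hence K^2. *)
pose K : R := (1 + (d - 1).+1%:R / eps) ^+ (d - 1).
have bound (u delta : R) : 0 < u <= 1 -> 0 < delta <= 1 ->
    C1 * delta `^ (- (2 * d%:R - 1)) * log_trunc delta^-1 ^+ (d - 1)
       * u `^ (- (2 * d%:R)) * log_trunc u^-1 ^+ (d - 1) <=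
    C1 * K ^+ 2 * u `^ (- (2 * d%:R + eps)) * delta `^ (- (2 * d%:R - 1 + eps)).
  move=> u01 delta01; have /andP[u0 _] := u01; have /andP[delta0 _] := delta01.
  have split_powR (x r : R) : 0 < x -> x `^ (- (r + eps)) = x `^ (- r) * x `^ (- eps).
    by move=> x0; rewrite opprD powRD// (gt_eqF x0) implybT.
  rewrite !split_powR//.
  have -> (a b c e f : R) : a * b * c * e * f = a * b * e * (c * f) by ring.
  have -> (a k b b' c c' : R) :
    a * k ^+ 2 * (b * b') * (c * c') = a * c * b * ((k * c') * (k * b')) by ring.
  rewrite ler_wpM2l//.
    rewrite !mulr_ge0 ?powR_ge0 ?exprn_ge0 ?ler0n//.
    by rewrite addr_ge0// ln_ge0// -natrM ler1n muln_gt0.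
  by apply: ler_pM; rewrite ?log_trunc_expr_le_powR// exprn_ge0//
    (le_trans ler01)// log_trunc_ge1.
exists C1, (C1 * K ^+ 2); split=> [u delta u01 delta01 B|u delta u01 delta01].
  by split; [exact: hyperrectangle_packing_le|exact: bound].
apply: le_trans (hyperrectangle_packing_le _ _ _ _ hd u01 delta01) _.
by rewrite lee_fin; exact: bound.
Qed.
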